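(* Let $k\ge 2$ be an integer and let $\mathcal{A}$ be a dual Banach algebra. If $(\mathcal{A}^{**},\Box)$ has the $k$-OA property, then $\mathcal{A}$ has the $k$-OA property.
   Context: All Banach algebras are over $\mathbb{C}$. For a Banach algebra $\mathcal{B}$, a $k$-homogeneous polynomial on $\mathcal{B}$ is a map $P:\mathcal{B}\to\mathbb{C}$ for which there is a bounded symmetric $k$-linear form $\Phi:\mathcal{B}^k\to\mathbb{C}$ with $P(x)=\Phi(x,\ldots,x)$ for all $x\in\mathcal{B}$. $P$ is orthogonally additive if $P(x+y)=P(x)+P(y)$ whenever $x,y\in\mathcal{B}$ satisfy $xy=0=yx$. $P$ is standard if there is $\gamma\in\mathcal{B}^*$ with $P(x)=\langle\gamma,x^k\rangle$ for all $x\in\mathcal{B}$. $\mathcal{B}$ has the $k$-OA property ($k$-orthogonally additive property) if every orthogonally additive $k$-homogeneous polynomial on $\mathcal{B}$ is standard. The bidual $\mathcal{A}^{**}$ is a Banach algebra with the first Arens product $\Box$, given by $m\Box n=\mathrm{w}^*\text{-}\lim_\alpha \mathrm{w}^*\text{-}\lim_\beta a_\alpha b_\beta$ for nets $(a_\alpha),(b_\beta)$ in $\mathcal{A}$ weak$^*$-converging to $m,n\in\mathcal{A}^{**}$ respectively (with $\mathcal{A}$ canonically embedded in $\mathcal{A}^{**}$). A Banach algebra $\mathcal{A}$ is a dual Banach algebra if $\mathcal{A}=F^*$ for some Banach space $F$ (a predual) such that $F$, canonically embedded in $F^{**}=\mathcal{A}^*$, is an $\mathcal{A}$-submodule of $\mathcal{A}^*$.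 *)

(* Defs.v *)
From HB Require Import structures.
From mathcomp Require Import all_boot all_order all_algebra.
From mathcomp Require Import perm.
From mathcomp Require Import boolp classical_sets functions reals.
From mathcomp Require Import topology normedtype.
From mathcomp Require Import complex.

Set Implicit Arguments.
Unset Strict Implicit.
Unset Printing Implicit Defensive.
Import Order.TTheory GRing.Theory Num.Theory.
Import numFieldNormedType.Exports.
Local Open Scope classical_set_scope.
Local Open Scope ring_scope.
Local Open Scope complex_scope.

Section ComplexComplete.
Variable R : realType.
Implicit Types z : R[i].

Lemma Re_le_norm z : `|complex.Re z| <= complex.Re `|z|.
Proof. by have := normc_ge_Re z; rewrite lecE => /andP[]. Qed.

Lemma norm_ReE z : `|z| = (complex.Re `|z|)%:C.
Proof. by rewrite RRe_real// normr_real. Qed.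

Lemma Im_le_norm z : `|complex.Im z| <= complex.Re `|z|.
Proof.
have := Re_le_norm (z * 'i%C); rewrite ReiNIm normrN normrM.
suff -> : `|'i%C : R[i]| = 1 by rewrite mulr1.
by rewrite normc_def/= expr0n/= add0r expr1n sqrtr1.
Qed.

Lemma norm_le_ReIm z : `|z| <= (`|complex.Re z| + `|complex.Im z|)%:C.
Proof.
rewrite {1}[z]complexE (le_trans (ler_normD _ _))// normrM.
have -> : `|'i%C : R[i]| = 1 by rewrite normc_def/= expr0n/= add0r expr1n sqrtr1.
rewrite mul1r rmorphD/= lerD//.
  by rewrite normc_def/= expr0n/= addr0 sqrtr_sqr.
by rewrite normc_def/= expr0n/= addr0 sqrtr_sqr.
Qed.

Lemma norm_sub_le_ReIm (a b : R) z :
  `|(a +i* b) - z| <= (`|a - complex.Re z| + `|b - complex.Im z|)%:C.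
Proof. by case: z => u v; exact: norm_le_ReIm. Qed.

Lemma cvg_part (P : R[i]^o -> R^o) (F : set_system (R[i]^o)) :
  (forall x y, `|P x - P y| <= complex.Re `|x - y|) ->
  ProperFilter F -> cauchy F -> exists a : R^o, P @ F --> a.
Proof.
move=> PP FF Fc.
suff /cauchy_cvg/cvg_ex : cauchy (P @ F) by [].
apply/cauchy_ballP => e e0.
have /cauchy_ballP /(_ (e%:C)) := Fc; rewrite ltcR => /(_ e0).
case => -[U V]/= [FU FV] UV.
exists (P @` U, P @` V) => /=.
  split; [apply: filterS FU | apply: filterS FV] => z zU /=; by exists z.
move=> [_ _] [/= [x Ux <-] [y Vy <-]].
have := UV (x, y) (conj Ux Vy).
rewrite -!ball_normE/= => xy.
by rewrite (le_lt_trans (PP _ _))// -ltcR -norm_ReE.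
Qed.

Lemma complex_complete (F : set_system (R[i]^o)) :
  ProperFilter F -> cauchy F -> exists l : R[i]^o, F --> l.
Proof.
move=> FF Fc.
have [|a /cvgrPdist_lt Fa] := @cvg_part (@complex.Re R) F _ FF Fc.
  by move=> [? ?] [? ?]; exact: (le_trans _ (Re_le_norm _)).
have [|b /cvgrPdist_lt Fb] := @cvg_part (@complex.Im R) F _ FF Fc.
  by move=> [? ?] [? ?]; exact: (le_trans _ (Im_le_norm _)).
exists (a +i* b); apply/cvgrPdist_lt => e e0.
have [eE _] : e = (complex.Re e)%:C /\ True by rewrite RRe_real// gtr0_real.
have e'0 : 0 < complex.Re e / 2 by rewrite divr_gt0// -ltcR -eE.
near=> z.
have h1 : `|a - complex.Re z| < complex.Re e / 2 by near: z; exact: Fa.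
have h2 : `|b - complex.Im z| < complex.Re e / 2 by near: z; exact: Fb.
rewrite (le_lt_trans (norm_sub_le_ReIm _ _ _))// eE ltcR.
by rewrite (splitr (complex.Re e)) ltrD.
Unshelve. all: by end_near. Qed.

End ComplexComplete.

Lemma real_complexM (R : realType) (x y : R) : (x * y)%:C = x%:C * y%:C.
Proof. exact: rmorphM. Qed.

Lemma real_complexV (R : realType) (x : R) : (x^-1)%:C = (x%:C)^-1.
Proof. exact: fmorphV. Qed.

Lemma cvg_norm_le (K : numFieldType) (V : normedModType K) T
    (F : set_system T) (FF : ProperFilter F) (h : T -> V) (l : V) (M : K) :
  h @ F --> l -> (\forall t \near F, `|h t| <= M) -> `|l| <= M.
Proof.
move=> /cvgrPdist_le hl hM; apply/ler_addgt0Pr => e e0.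
have [t [ht tM]] := filter_ex (filterI (hl e e0) hM).
by rewrite -[l](subrK (h t)) (le_trans (ler_normD _ _))// addrC lerD.
Qed.
Arguments cvg_norm_le {K V T F FF} h.

Section Dual.
Variables (R : realType) (E : normedModType R[i]).

(* The topological dual of [E]. [R[i]^o] is [R[i]] seen as a normed module over
   itself, so that [linear] means C-linear. *)
Record dual := Dual {
  dual_fun :> E -> R[i]^o;
  dual_linear : linear dual_fun;
  dual_continuous : continuous dual_fun }.

Lemma dual_ext (f g : dual) : (forall x, f x = g x) -> f = g.
Proof.
case: f g => [f fl fc] [g gl gc] /= /funext fg; subst g.
by congr Dual; exact: Prop_irrelevance.
Qed.

End Dual.

HB.instance Definition _ (R : realType) (E : normedModType R[i]) :=
  gen_eqMixin (dual E).
HB.instance Definition _ (R : realType) (E : normedModType R[i]) :=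
  gen_choiceMixin (dual E).

HB.instance Definition _ (R : realType) (E : normedModType R[i]) (f : dual E) :=
  GRing.isLinear.Build R[i] E (R[i]^o) _ (dual_fun f) (dual_linear f).

Section DualSpace.
Variables (R : realType) (E : normedModType R[i]).
Implicit Types (f g : dual E) (x : E).

Lemma bounded_linear_dual (f : E -> R[i]^o) : linear f ->
  (exists M, forall x, `|f x| <= M * `|x|) -> continuous f.
Proof.
move=> lf [M fM]; pose lf' := GRing.isLinear.Build R[i] E (R[i]^o) _ f lf.
pose f' : {linear E -> R[i]^o} := HB.pack f lf'.
apply: (@bounded_linear_continuous _ _ _ f'); apply/linear_boundedP.
have M'0 : 0 <= `|M| by [].
exists `|M|; split; first exact: ger0_real.
move=> M' MM' x; rewrite (le_trans (fM x))//.
have M0 : M * `|x| \is Num.real by rewrite ger0_real// (le_trans _ (fM x)).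
rewrite (le_trans (real_ler_norm M0))// normrM normr_id ler_wpM2r//.
exact: ltW.
Qed.

Lemma dual_bounded f : exists2 M : R, 0 <= M & forall x, `|f x| <= M%:C * `|x|.
Proof.
have : bounded_near f (nbhs (0 : E)).
  by apply/linear_bounded_continuous; exact: dual_continuous.
move=> /linear_boundedP /pinfty_ex_gt0 [M M0 fM].
exists (complex.Re M); first by rewrite -lecR RRe_real ?gtr0_real// ltW.
by move=> x; rewrite RRe_real ?gtr0_real//; exact: fM.
Qed.

Definition dual_of (f : E -> R[i]^o) (lf : linear f)
    (bf : exists M, forall x, `|f x| <= M * `|x|) : dual E :=
  Dual lf (bounded_linear_dual lf bf).

Lemma dual_zero_subproof : linear (fun _ : E => 0 : R[i]^o).
Proof. by move=> a x y; rewrite scaler0 addr0. Qed.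
Definition dual_zero := Dual dual_zero_subproof (@cst_continuous _ _ _).

Lemma dual_add_subproof f g : linear (fun x => f x + g x).
Proof. by move=> a x y; rewrite !linearP scalerDr addrACA. Qed.
Definition dual_add f g := Dual (dual_add_subproof f g)
  (fun x => continuousD (@dual_continuous _ _ f x) (@dual_continuous _ _ g x)).

Lemma dual_opp_subproof f : linear (fun x => - f x).
Proof. by move=> a x y; rewrite linearP opprD scalerN. Qed.
Definition dual_opp f := Dual (dual_opp_subproof f)
  (fun x => continuousN (@dual_continuous _ _ f x)).

Lemma dual_scale_subproof (a : R[i]) f : linear (fun x => a *: f x).
Proof. by move=> b x y; rewrite linearP scalerDr !scalerA mulrC. Qed.
Definition dual_scale a f := Dual (dual_scale_subproof a f)
  (fun x => continuousZl_tmp (@dual_continuous _ _ f x)).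

End DualSpace.

Section DualZmod.
Variables (R : realType) (E : normedModType R[i]).
Implicit Types (f g : dual E).

Lemma dual_addA : associative (@dual_add R E).
Proof. by move=> f g h; apply: dual_ext => x /=; rewrite addrA. Qed.
Lemma dual_addC : commutative (@dual_add R E).
Proof. by move=> f g; apply: dual_ext => x /=; rewrite addrC. Qed.
Lemma dual_add0 : left_id (dual_zero E) (@dual_add R E).
Proof. by move=> f; apply: dual_ext => x /=; rewrite add0r. Qed.
Lemma dual_addN : left_inverse (dual_zero E) (@dual_opp R E) (@dual_add R E).
Proof. by move=> f; apply: dual_ext => x /=; rewrite addNr. Qed.

End DualZmod.

HB.instance Definition _ (R : realType) (E : normedModType R[i]) :=
  GRing.isZmodule.Build (dual E)
    (@dual_addA R E) (@dual_addC R E) (@dual_add0 R E) (@dual_addN R E).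

Section DualLmod.
Variables (R : realType) (E : normedModType R[i]).
Implicit Types (f g : dual E).

Lemma dual_scaleA (a b : R[i]) f :
  dual_scale a (dual_scale b f) = dual_scale (a * b) f.
Proof. by apply: dual_ext => x /=; rewrite scalerA. Qed.
Lemma dual_scale1 : left_id 1 (@dual_scale R E).
Proof. by move=> f; apply: dual_ext => x /=; rewrite scale1r. Qed.
Lemma dual_scaleDr : right_distributive (@dual_scale R E) +%R.
Proof. by move=> a f g; apply: dual_ext => x /=; rewrite scalerDr. Qed.
Lemma dual_scaleDl f : {morph (@dual_scale R E)^~ f : a b / a + b}.
Proof. by move=> a b; apply: dual_ext => x /=; rewrite scalerDl. Qed.

End DualLmod.

HB.instance Definition _ (R : realType) (E : normedModType R[i]) :=
  GRing.Zmodule_isLmodule.Build R[i] (dual E)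
    (@dual_scaleA R E) (@dual_scale1 R E) (@dual_scaleDr R E)
    (@dual_scaleDl R E).

Section DualNorm.
Variables (R : realType) (E : normedModType R[i]).
Implicit Types (f g : dual E) (x : E).

Lemma dualDE f g x : (f + g) x = f x + g x. Proof. by []. Qed.
Lemma dualNE f x : (- f) x = - f x. Proof. by []. Qed.
Lemma dualBE f g x : (f - g) x = f x - g x. Proof. by []. Qed.
Lemma dualZE (a : R[i]) f x : (a *: f) x = a *: f x. Proof. by []. Qed.

(* Norms of a [normedModType K] take their values in [K], here R[i]; suprema are
   available in R only, hence the passage through the real part. *)
Definition opnorm f : R :=
  sup [set complex.Re `|f x| | x in [set x : E | `|x| <= 1]].

Let opnorm_set_sup f :
  has_sup [set complex.Re `|f x| | x in [set x : E | `|x| <= 1]].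
Proof.
split; first by exists (complex.Re `|f 0|), 0 => //=; rewrite normr0.
have [M M0 fM] := dual_bounded f.
exists M => _ [x /= x1 <-]; rewrite -lecR -norm_ReE.
by rewrite (le_trans (fM x))// ler_piMr// ler0c.
Qed.

Lemma opnorm_ge0 f : 0 <= opnorm f.
Proof.
apply: (le_trans (_ : _ <= complex.Re `|f 0|)); first by rewrite linear0 normr0.
by apply: ub_le_sup; [case: (opnorm_set_sup f) | exists 0 => //=; rewrite normr0].
Qed.

Lemma ler_opnorm f x : `|f x| <= (opnorm f)%:C * `|x|.
Proof.
have [->|x0] := eqVneq x 0; first by rewrite linear0 !normr0 mulr0.
have nx0 : 0 < `|x| by rewrite normr_gt0.
rewrite -ler_pdivrMr// mulrC -[X in X * _]ger0_norm ?invr_ge0//.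
rewrite -[`|f x|]/(`|(f x : R[i]^o)|) -normrZ -linearZ/=.
rewrite norm_ReE lecR; apply: ub_le_sup; first by case: (opnorm_set_sup f).
exists (`|x|^-1 *: x) => //=.
by rewrite normrZ ger0_norm ?invr_ge0// mulVf ?normr_eq0.
Qed.

Lemma opnorm_le f (M : R) : 0 <= M -> (forall x, `|f x| <= M%:C * `|x|) ->
  opnorm f <= M.
Proof.
move=> M0 fM; apply: ge_sup; first by case: (opnorm_set_sup f).
move=> _ [x /= x1 <-]; rewrite -lecR -norm_ReE.
by rewrite (le_trans (fM x))// ler_piMr// ler0c.
Qed.

Definition dual_norm f : R[i] := (opnorm f)%:C.

Lemma dual_normD f g : dual_norm (f + g) <= dual_norm f + dual_norm g.
Proof.
rewrite /dual_norm -rmorphD lecR; apply: opnorm_le => [|x].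
  by rewrite addr_ge0// opnorm_ge0.
by rewrite rmorphD/= mulrDl (le_trans (ler_normD _ _))// lerD// ler_opnorm.
Qed.

Lemma dual_normZ (a : R[i]) f : dual_norm (a *: f) = `|a| * dual_norm f.
Proof.
rewrite /dual_norm norm_ReE -real_complexM; congr (_ %:C).
have a0 : 0 <= complex.Re `|a| by rewrite -ler0c -norm_ReE.
apply/eqP; rewrite eq_le; apply/andP; split.
  apply: opnorm_le => [|x]; first by rewrite mulr_ge0// opnorm_ge0.
  by rewrite real_complexM -norm_ReE -mulrA normrZ ler_wpM2l// ler_opnorm.
have [->|an0] := eqVneq a 0; first by rewrite normr0 mul0r opnorm_ge0.
have pa : 0 < complex.Re `|a| by rewrite -ltcR -norm_ReE normr_gt0.
rewrite mulrC -ler_pdivlMr//; apply: opnorm_le => [|x].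
  by rewrite divr_ge0// opnorm_ge0.
rewrite real_complexM real_complexV -norm_ReE mulrAC ler_pdivlMr ?normr_gt0//.
by rewrite mulrC -[X in X <= _]normrZ -dualZE ler_opnorm.
Qed.

Lemma dual_norm0_eq0 f : dual_norm f = 0 -> f = 0.
Proof.
move=> f0; apply: dual_ext => x; apply/eqP; rewrite -normr_le0.
by rewrite (le_trans (ler_opnorm f x))// [_%:C]f0 mul0r.
Qed.

End DualNorm.

HB.instance Definition _ (R : realType) (E : normedModType R[i]) :=
  @Lmodule_isNormed.Build R[i] (dual E) (@dual_norm R E)
    (@dual_normD R E) (@dual_normZ R E) (@dual_norm0_eq0 R E).

Section DualComplete.
Variables (R : realType) (E : normedModType R[i]).
Implicit Types (f g : dual E) (x : E).

Lemma ler_dual_norm f x : `|f x| <= `|f| * `|x|.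
Proof. exact: ler_opnorm. Qed.

Lemma dual_norm_le f (M : R[i]) : 0 <= M -> (forall x, `|f x| <= M * `|x|) ->
  `|f| <= M.
Proof.
move=> M0; have <- : (complex.Re M)%:C = M by rewrite RRe_real// ger0_real.
move=> fM; rewrite [leLHS]/(dual_norm f) lecR; apply: opnorm_le => //.
by rewrite -ler0c RRe_real// ger0_real.
Qed.

Lemma dual_complete (F : set_system (dual E)) :
  ProperFilter F -> cauchy F -> cvg F.
Proof.
move=> FF /cauchy_ballP Fc.
have Fx x : exists l : R[i]^o, (fun f => f x) @ F --> l.
  apply: complex_complete; apply/cauchy_ballP => e e0.
  have d0 : 0 < e / (`|x| + 1) by rewrite divr_gt0// ltr_wpDl.
  case: (Fc _ d0) => -[U V]/= [FU FV] UV.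
  exists ((fun f => f x) @` U, (fun f => f x) @` V) => /=.
    by split; [apply: filterS FU | apply: filterS FV] => f fU /=; exists f.
  move=> [_ _] [/= [f Uf <-] [g Vg <-]].
  have := UV (f, g) (conj Uf Vg); rewrite -!ball_normE/= => fg.
  rewrite -dualBE (le_lt_trans (ler_dual_norm _ _))//.
  rewrite (@le_lt_trans _ _ (`|f - g| * (`|x| + 1)))//.
    by rewrite ler_wpM2l// lerDl.
  by rewrite -ltr_pdivlMr// ltr_wpDl.
pose l x : R[i]^o := projT1 (cid (Fx x)).
have Fl x : (fun f => f x) @ F --> l x by exact: projT2 (cid (Fx x)).
have ll : linear l.
  move=> a x y; apply: (@cvg_unique _ (@norm_hausdorff _ R[i]^o) _ _ _ _ (Fl _)).
  rewrite (_ : (fun f => f _) = (fun f => a *: f x + f y)); last first.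
    by apply/funext => f; rewrite linearP.
  by apply: cvgD => //; apply: cvgZl_tmp.
have near_l (e : R[i]) : 0 < e ->
    \forall f \near F, forall x, `|l x - (f : dual E) x| <= e * `|x|.
  move=> e0; case: (Fc _ e0) => -[U V]/= [FU FV] UV.
  apply: filterS FV => g Vg x.
  apply: (@cvg_norm_le _ _ _ F FF (fun f : dual E => f x - g x)).
    exact: (cvgB (Fl x) (cvg_cst _)).
  apply: filterS FU => f Uf.
  have := UV (f, g) (conj Uf Vg); rewrite -ball_normE/= => /ltW fg.
  by apply: (le_trans (ler_dual_norm (f - g) x)); rewrite ler_wpM2r.
have bl : exists M, forall x, `|l x| <= M * `|x|.
  have [f lf] := @filter_ex _ F _ _ (near_l 1 ltr01).
  exists (1 + `|f|) => x; rewrite -[l x](subrK (f x)) (le_trans (ler_normD _ _))//.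
  by rewrite mulrDl lerD// ler_dual_norm.
apply/cvg_ex; exists (dual_of ll bl); apply/cvgrPdist_le => e e0.
apply: filterS (near_l e e0) => f lf.
by apply: dual_norm_le => //; exact: ltW.
Qed.

End DualComplete.

HB.instance Definition _ (R : realType) (E : normedModType R[i]) :=
  Uniform_isComplete.Build (dual E) (@dual_complete R E).

Definition bidual (R : realType) (E : normedModType R[i]) := dual (dual E).

HB.instance Definition _ (R : realType) (E : normedModType R[i]) :=
  CompleteNormedModule.copy (bidual E) (dual (dual E)).

Section Embedding.
Variables (R : realType) (E : normedModType R[i]).

Lemma bidual_embed_linear (x : E) : linear (fun f : dual E => f x).
Proof. by []. Qed.

Lemma bidual_embed_bounded (x : E) :
  exists M, forall f : dual E, `|f x| <= M * `|f|.
Proof. by exists `|x| => f; rewrite mulrC ler_dual_norm. Qed.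

Definition bidual_embed (x : E) : bidual E :=
  dual_of (bidual_embed_linear x) (bidual_embed_bounded x).

End Embedding.

Section WeakStar.
Variables (R : realType) (E : normedModType R[i]).
Implicit Types (f g : dual E) (m : bidual E) (s : seq (dual E)).

(* The filter on [E] of the nets in [E] that converge weak-star to [m]: the trace
   on [E] of the weak-star neighbourhoods of [m] in the bidual. *)
Definition wstar_nbhs m : set_system E :=
  [set U | exists s (e : R), 0 < e /\
    [set a | forall f, f \in s -> `|f a - m f| < e%:C] `<=` U].

(* If [g] vanishes on the common kernel of [s] then it is in the span of [s], so
   any interpolation of [m] on [s] interpolates [m] at [g]. *)
Lemma dual_span_subproof s g :
  (forall x, (forall f, f \in s -> f x = 0) -> g x = 0) ->
  forall m x, (forall f, f \in s -> f x = m f) -> g x = m g.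
Proof.
elim: s g => [|h s IHs] g gs m x xm.
  have -> : g = 0 by apply: dual_ext => y; rewrite gs.
  by rewrite linear0.
have [hs|] := pselect (forall y, (forall f, f \in s -> f y = 0) -> h y = 0).
  apply: (IHs g) => [y ys|f fs]; last by rewrite xm// inE fs orbT.
  by apply: gs => f; rewrite inE => /predU1P[->|/ys//]; exact: hs.
move=> /existsNP[b /not_implyP[bs /eqP hb0]].
have := IHs (g - (g b / h b) *: h) _ m x.
have -> : m (g - (g b / h b) *: h) = m g - (g b / h b) *: m h.
  by rewrite linearB linearZ.
rewrite dualBE dualZE (xm h) ?mem_head// => gE; apply/(addIr _)/gE => [y ys|f fs]; last first.
  by rewrite xm// inE fs orbT.
rewrite dualBE dualZE.
have -> : g b / h b *: (h y : R[i]^o) = h y / h b *: (g b : R[i]^o).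
  by rewrite /GRing.scale/= mulrAC [_ * h y]mulrC mulrAC.
rewrite -linearZ -linearB; apply: gs => f; rewrite linearB linearZ/= inE => /predU1P[->|fs].
  by rewrite /GRing.scale/= divfK// subrr.
by rewrite (ys f)// (bs f)// ?scaler0 ?mulr0 subr0.
Qed.

Lemma wstar_interpolate m s : exists x : E, forall f, f \in s -> f x = m f.
Proof.
elim: s => [|g s [x xm]]; first by exists 0.
have [gs|] := pselect (forall y, (forall f, f \in s -> f y = 0) -> g y = 0).
  exists x => f; rewrite inE => /predU1P[->|/xm//].
  exact: (dual_span_subproof gs).
move=> /existsNP[b /not_implyP[bs /eqP gb0]].
exists (x + ((m g - g x) / g b) *: b) => f; rewrite inE linearD linearZ/=.
move=> /predU1P[->|fs]; first by rewrite /GRing.scale/= divfK// addrC subrK.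
by rewrite (bs f)// ?scaler0 ?mulr0 addr0 xm.
Qed.

Global Instance wstar_nbhs_filter m : ProperFilter (wstar_nbhs m).
Proof.
split.
  move=> [s [e [e0 sub]]]; have [x xm] := wstar_interpolate m s.
  by apply: (sub x) => f fs; rewrite xm// subrr normr0 ltcR.
split.
- by exists [::], 1; split.
- move=> U V [s [e [e0 sU]]] [t [d [d0 tV]]].
  exists (s ++ t), (Num.min e d); split; first by rewrite lt_min e0.
  move=> a ast; split; [apply: sU | apply: tV] => f fs.
    by rewrite (lt_le_trans (ast _ _)) ?mem_cat ?fs// lecR ge_min lexx.
  by rewrite (lt_le_trans (ast _ _)) ?mem_cat ?fs ?orbT// lecR ge_min lexx orbT.
- by move=> U V UV [s [e [e0 sU]]]; exists s, e; split=> //; exact: subset_trans UV.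
Qed.

Lemma wstar_nbhs_cvg m f : f @ wstar_nbhs m --> m f.
Proof.
apply/cvgrPdist_lt => e e0; exists [:: f], (complex.Re e).
have eE : (complex.Re e)%:C = e by rewrite RRe_real// gtr0_real.
split; first by rewrite -ltcR eE.
by move=> a /(_ f); rewrite mem_head distrC eE; apply.
Qed.

Lemma wstar_nbhsP m (F : set_system E) : Filter F ->
  (forall f, f @ F --> m f) <-> F --> wstar_nbhs m.
Proof.
move=> FF; split=> [Fm U [s [e [e0 sU]]]|Fm f]; last first.
  exact: cvg_trans (cvg_app _ Fm) (@wstar_nbhs_cvg m f).
apply: (filterS sU); elim: s {sU} => [|f s IHs]; first exact: filterS filterT.
have /cvgrPdist_lt/(_ e%:C) := Fm f; rewrite ltcR => /(_ e0) fe.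
apply: filterS (filterI IHs fe) => a [/= sa fa] g.
by rewrite inE => /predU1P[->|/sa//]; rewrite distrC.
Qed.

End WeakStar.

(* No unit is assumed, which rules out the ring structures of the library. *)
HB.mixin Record CompleteNormedModule_isBanachAlgebra (K : numFieldType) A
    of CompleteNormedModule K A := {
  bmul : A -> A -> A;
  bmulA : associative bmul;
  bmulDl : left_distributive bmul +%R;
  bmulDr : right_distributive bmul +%R;
  bmulZl : forall (c : K) x y, bmul (c *: x) y = c *: bmul x y;
  bmulZr : forall (c : K) x y, bmul x (c *: y) = c *: bmul x y;
  ler_bmul : forall x y, `|bmul x y| <= `|x| * `|y| }.

#[short(type="banachAlgType")]
HB.structure Definition BanachAlgebra (K : numFieldType) :=
  {A of CompleteNormedModule K A & CompleteNormedModule_isBanachAlgebra K A}.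

Declare Scope banach_scope.
Delimit Scope banach_scope with BA.
Notation "x ** y" := (bmul x y) (at level 40, left associativity) : banach_scope.
Local Open Scope banach_scope.

Section DualModule.
Variables (R : realType) (A : banachAlgType R[i]).
Implicit Types (a b x : A) (f g : dual A).

Lemma dual_lact_linear a f : linear (fun x => f (x ** a)).
Proof. by move=> c x y; rewrite bmulDl bmulZl linearP. Qed.

Lemma dual_lact_bounded a f :
  exists M, forall x, `|f (x ** a)| <= M * `|x|.
Proof.
exists (`|f| * `|a|) => x; rewrite (le_trans (ler_dual_norm _ _))//.
by rewrite -mulrA ler_wpM2l// mulrC ler_bmul.
Qed.

(* <a.f, x> = <f, xa> *)
Definition dual_lact a f : dual A :=
  dual_of (dual_lact_linear a f) (dual_lact_bounded a f).

Lemma dual_ract_linear f a : linear (fun x => f (a ** x)).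
Proof. by move=> c x y; rewrite bmulDr bmulZr linearP. Qed.

Lemma dual_ract_le f a x : `|f (a ** x)| <= `|f| * `|a| * `|x|.
Proof.
rewrite (le_trans (ler_dual_norm _ _))//.
by rewrite -mulrA ler_wpM2l// ler_bmul.
Qed.

(* <f.a, x> = <f, ax> *)
Definition dual_ract f a : dual A :=
  dual_of (dual_ract_linear f a) (ex_intro _ _ (dual_ract_le f a)).

Definition dual_submodule (S : set (dual A)) : Prop :=
  [/\ S 0, forall f g, S f -> S g -> S (f + g),
      forall (c : R[i]) f, S f -> S (c *: f),
      forall a f, S f -> S (dual_lact a f) &
      forall f a, S f -> S (dual_ract f a)].

End DualModule.

Section Arens.
Variables (R : realType) (A : banachAlgType R[i]).
Implicit Types (a b : A) (f : dual A) (m n : bidual A).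

(* The first Arens product, evaluated at [f]: the iterated weak-star limit of
   [a ** b] as [a] tends to [m], outer, and [b] tends to [n], inner. By
   [arens_cvg] any pair of filters on [A] converging weak-star to [m] and [n]
   computes the same functional. *)
Definition arens_fun m n f : R[i]^o :=
  lim ((fun a => lim ((fun b => f (a ** b)) @ wstar_nbhs n)) @ wstar_nbhs m).

Lemma bidual_act_linear n f : linear (fun a => n (dual_ract f a)).
Proof.
move=> c x y; rewrite -linearP; congr (n _); apply: dual_ext => z /=.
by rewrite bmulDl bmulZl linearP.
Qed.

Lemma bidual_act_le n f a : `|n (dual_ract f a)| <= `|n| * `|f| * `|a|.
Proof.
rewrite (le_trans (ler_dual_norm _ _))// -mulrA ler_wpM2l//.
by apply: dual_norm_le => [|x]; rewrite ?mulr_ge0// dual_ract_le.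
Qed.

(* The functional n.f : a |-> <n, f.a>, so that <arens m n, f> = <m, n.f>. *)
Definition bidual_act n f : dual A :=
  dual_of (bidual_act_linear n f) (ex_intro _ _ (bidual_act_le n f)).

Lemma iterated_cvg m n f (F G : set_system A) :
  ProperFilter F -> ProperFilter G ->
  (forall g : dual A, g @ F --> m g) -> (forall g : dual A, g @ G --> n g) ->
  (forall a, (fun b => f (a ** b)) @ G --> n (dual_ract f a)) /\
  (fun a => lim ((fun b => f (a ** b)) @ G)) @ F --> m (bidual_act n f).
Proof.
move=> FF FG Fm Gn.
have Gc a : (fun b => f (a ** b)) @ G --> n (dual_ract f a).
  exact: (Gn (dual_ract f a)).
split=> //; rewrite (_ : (fun a => _) = bidual_act n f); first exact: Fm.
apply/funext => a.
exact: (cvg_lim (@norm_hausdorff _ R[i]^o) (Gc a)).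
Qed.

Lemma arens_funE m n f : arens_fun m n f = m (bidual_act n f).
Proof.
have [_] := @iterated_cvg m n f _ _ (wstar_nbhs_filter m) (wstar_nbhs_filter n)
  (@wstar_nbhs_cvg _ _ m) (@wstar_nbhs_cvg _ _ n).
apply: (@cvg_lim _ (@norm_hausdorff _ R[i]^o) _ _ (wstar_nbhs_filter m)).
Qed.

Lemma arens_linear m n : linear (arens_fun m n).
Proof.
move=> c f g; rewrite !arens_funE -linearP; congr (m _).
apply: dual_ext => a /=; rewrite -linearP; congr (n _); exact: dual_ext.
Qed.

Lemma arens_le m n f : `|arens_fun m n f| <= `|m| * `|n| * `|f|.
Proof.
rewrite arens_funE (le_trans (ler_dual_norm _ _))// -mulrA ler_wpM2l//.
by apply: dual_norm_le => [|a]; rewrite ?mulr_ge0// bidual_act_le.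
Qed.

Definition arens m n : bidual A :=
  dual_of (arens_linear m n) (ex_intro _ _ (arens_le m n)).

Lemma arensE m n f : arens m n f = m (bidual_act n f).
Proof. exact: arens_funE. Qed.

Lemma arens_cvg m n f (F G : set_system A) :
  ProperFilter F -> ProperFilter G ->
  (forall g : dual A, g @ F --> m g) -> (forall g : dual A, g @ G --> n g) ->
  (fun a => lim ((fun b => f (a ** b)) @ G)) @ F --> arens m n f.
Proof.
by move=> FF FG Fm Gn; rewrite arensE; apply: (iterated_cvg f FF FG Fm Gn).2.
Qed.

Lemma arensA : associative arens.
Proof.
move=> m n p; apply: dual_ext => f; rewrite !arensE; congr (m _).
apply: dual_ext => a; rewrite /= arens_funE; congr (n _).
apply: dual_ext => b /=; congr (p _); apply: dual_ext => c /=.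
by rewrite bmulA.
Qed.

Lemma arensDl : left_distributive arens +%R.
Proof. by move=> m n p; apply: dual_ext => f; rewrite dualDE !arensE. Qed.

Lemma arensDr : right_distributive arens +%R.
Proof.
move=> m n p; apply: dual_ext => f; rewrite dualDE !arensE -linearD.
by congr (m _); apply: dual_ext.
Qed.

Lemma arensZl (c : R[i]) m n : arens (c *: m) n = c *: arens m n.
Proof. by apply: dual_ext => f; rewrite dualZE !arensE. Qed.

Lemma arensZr (c : R[i]) m n : arens m (c *: n) = c *: arens m n.
Proof.
apply: dual_ext => f; rewrite dualZE !arensE -linearZ.
by congr (m _); apply: dual_ext.
Qed.

Lemma ler_arens m n : `|arens m n| <= `|m| * `|n|.
Proof. by apply: dual_norm_le => [|f]; rewrite ?mulr_ge0// arens_le. Qed.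

End Arens.

(* [bidual A] is henceforth the Banach algebra with the first Arens product. *)
HB.instance Definition _ (R : realType) (A : banachAlgType R[i]) :=
  CompleteNormedModule_isBanachAlgebra.Build R[i] (bidual A)
    (@arensA R A) (@arensDl R A) (@arensDr R A)
    (@arensZl R A) (@arensZr R A) (@ler_arens R A).

Section OrthogonallyAdditive.
Variables (R : realType) (k : nat) (B : banachAlgType R[i]).

(* x^k; without a unit, only meaningful for k > 0. *)
Definition bpow (x : B) : B := iter k.-1 (bmul x) x.

Definition multilinear_form (Phi : ('I_k -> B) -> R[i]^o) : Prop :=
  forall (v : 'I_k -> B) (i : 'I_k),
    linear (fun x : B => Phi (fun j => if j == i then x else v j)).

Definition symmetric_form (Phi : ('I_k -> B) -> R[i]^o) : Prop :=
  forall (s : 'S_k) (v : 'I_k -> B), Phi (v \o s) = Phi v.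

Definition bounded_form (Phi : ('I_k -> B) -> R[i]^o) : Prop :=
  exists M : R[i], forall v : 'I_k -> B, `|Phi v| <= M * \prod_i `|v i|.

Definition homogeneous_polynomial (P : B -> R[i]^o) : Prop :=
  exists Phi : ('I_k -> B) -> R[i]^o,
    [/\ multilinear_form Phi, symmetric_form Phi, bounded_form Phi &
        forall x, P x = Phi (fun=> x)].

Definition orthogonally_additive (P : B -> R[i]^o) : Prop :=
  forall x y : B, x ** y = 0 -> y ** x = 0 -> P (x + y) = P x + P y.

Definition standard_polynomial (P : B -> R[i]^o) : Prop :=
  exists gamma : dual B, forall x, P x = gamma (bpow x).

Definition OA_property : Prop := forall P : B -> R[i]^o,
  homogeneous_polynomial P -> orthogonally_additive P -> standard_polynomial P.

End OrthogonallyAdditive.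

Section DualBanachAlgebra.
Variables (R : realType) (A : banachAlgType R[i]).

(* The canonical image of [F] in F** = A*, when [iota] identifies A with F*. *)
Definition predual_image (F : normedModType R[i]) (iota : A -> dual F) :
    set (dual A) :=
  [set f | exists phi : F, forall a, f a = bidual_embed phi (iota a)].

Definition dual_banach_algebra : Prop :=
  exists (F : completeNormedModType R[i]) (iota : {linear A -> dual F}),
    [/\ bijective iota, forall a, `|iota a| = `|a| &
        dual_submodule (predual_image iota)].

End DualBanachAlgebra.

(* Main.v *)
(** Restricting functionals on [A*] to the predual [F] gives a contractive
    linear projection of [A**] onto [A = F*]. As [F] is a submodule of [A*], the
    projection is multiplicative for the first Arens product, so it carries
    orthogonal pairs to orthogonal pairs. Hence an orthogonally additive
    polynomial [P] on [A] pulls back to one on [A**]; if [Gamma] represents the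
    pullback, the restriction of [Gamma] to [A] represents [P]. *)

Require Import Defs.
From mathcomp Require Import all_boot all_order all_algebra.
From mathcomp Require Import reals complex.
From HB Require Import structures.
From mathcomp Require Import boolp normedtype.

Set Implicit Arguments.
Unset Strict Implicit.
Unset Printing Implicit Defensive.
Import Order.TTheory GRing.Theory Num.Theory.
Import numFieldNormedType.Exports.
Local Open Scope ring_scope.
Local Open Scope complex_scope.
Local Open Scope banach_scope.

(** The constant [M] is an arbitrary scalar, but [M * |x|] dominates a norm, so it is nonnegative
    and equals its own norm. The bound then becomes one that can be raised to powers and
    multiplied. *)
Lemma linear_le_norm (K : numFieldType) (E F : normedModType K) (f : E -> F)
    (M : K) :
  (forall x, `|f x| <= M * `|x|) -> forall x, `|f x| <= `|M| * `|x|.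
Proof.
move=> fM x; rewrite (le_trans (fM x))//.
have /ger0_norm <- : 0 <= M * `|x| by exact: le_trans (fM x).
by rewrite normrM normr_id.
Qed.

Section Retract.
Variables (R : realType) (k : nat) (A B : banachAlgType R[i]).
Variables (p : {linear B -> A}) (e : {linear A -> B}).
Hypothesis pM : {morph p : x y / x ** y}.
Hypothesis eM : {morph e : x y / x ** y}.
Hypothesis p_bounded : exists M, forall x, `|p x| <= M * `|x|.
Hypothesis e_bounded : exists M, forall x, `|e x| <= M * `|x|.
Hypothesis eK : cancel e p.

Lemma bpow_morph x : e (bpow k x) = bpow k (e x).
Proof. by rewrite /bpow; elim: k.-1 => //= n IHn; rewrite eM IHn. Qed.

Lemma homogeneous_polynomial_comp (P : A -> R[i]^o) :
  homogeneous_polynomial k P -> homogeneous_polynomial k (P \o p).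
Proof.
case=> Phi [Phi_lin Phi_sym [M PhiM] PE].
exists (fun v => Phi (p \o v)); split.
- move=> v i c x y.
  have pE z : p \o (fun j => if j == i then z else v j) =
      (fun j => if j == i then p z else p (v j)).
    by apply/funext => j /=; case: ifP.
  by rewrite !pE linearP; exact: (Phi_lin (p \o v) i c).
- by move=> s v; exact: (Phi_sym s (p \o v)).
- case: p_bounded => N /linear_le_norm pN.
  exists (`|M| * `|N| ^+ k) => v.
  have -> : `|N| ^+ k = \prod_(i < k) `|N| by rewrite prodr_const card_ord.
  have prod0 : 0 <= \prod_i `|(p \o v) i| by exact: prodr_ge0.
  rewrite (le_trans (PhiM _))//.
  (* The sign of [M] is unknown here too; passing to the norm of the whole bound brings in [|M|]. *)
  have /ger0_norm <- : 0 <= M * \prod_i `|(p \o v) i|.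
    exact: le_trans (PhiM _).
  rewrite normrM (ger0_norm prod0) -mulrA -big_split/= ler_wpM2l//.
  by apply: ler_prod => i _; rewrite normr_ge0/=.
- by move=> x /=; rewrite PE.
Qed.

Lemma orthogonally_additive_comp (P : A -> R[i]^o) :
  orthogonally_additive P -> orthogonally_additive (P \o p).
Proof.
by move=> Padd x y xy yx /=; rewrite linearD Padd// -pM (xy, yx) linear0.
Qed.

(** The representing functional is [Gamma \o e]: since [x = p (e x)] and [e] preserves powers,
    [P x = Gamma ((e x)^k) = Gamma (e (x^k))]. *)
Lemma standard_polynomial_retract (P : A -> R[i]^o) :
  standard_polynomial k (P \o p) -> standard_polynomial k P.
Proof.
case=> Gamma PE.
have gl : linear (fun x => Gamma (e x)) by move=> c x y; rewrite !linearP.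
have gb : exists M, forall x, `|Gamma (e x)| <= M * `|x|.
  case: e_bounded => M eB; exists (`|Gamma| * M) => x.
  by rewrite (le_trans (ler_dual_norm _ _))// -mulrA ler_wpM2l.
exists (dual_of gl gb) => x /=.
by rewrite bpow_morph -PE /= eK.
Qed.

Lemma OA_property_retract : OA_property k B -> OA_property k A.
Proof.
move=> BOA P Phom Padd; apply/standard_polynomial_retract/BOA.
  exact: homogeneous_polynomial_comp.
exact: orthogonally_additive_comp.
Qed.

End Retract.

Section BidualEmbed.
Variables (R : realType) (A : banachAlgType R[i]).

Lemma linear_bidual_embed : linear (@bidual_embed R A).
Proof. by move=> c x y; apply: dual_ext => f /=; rewrite linearP. Qed.

Lemma bidual_embed_le (a : A) : `|bidual_embed a| <= `|a|.
Proof. by apply: dual_norm_le => // f; rewrite mulrC; exact: ler_dual_norm. Qed.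

(** When [n] is the image of [b], [bidual_act n f] is [x |-> f (x ** b)], so both sides take the
    value [f (a ** b)] at [f]. *)
Lemma bidual_embedM : {morph @bidual_embed R A : a b / a ** b}.
Proof. by move=> a b; apply: dual_ext => f; rewrite arensE. Qed.

End BidualEmbed.

Section PredualProjection.
Variables (R : realType) (A : banachAlgType R[i]).
Variables (F : normedModType R[i]) (iota : {linear A -> dual F}).
Variable iota_inv : dual F -> A.
Hypothesis iotaK : cancel iota iota_inv.
Hypothesis iota_invK : cancel iota_inv iota.
Hypothesis iota_isometry : forall a, `|iota a| = `|a|.
Hypothesis predual_submodule : dual_submodule (predual_image iota).

Lemma predual_functional_linear (phi : F) :
  linear (fun a => iota a phi : R[i]^o).
Proof. by move=> c a b; rewrite linearP. Qed.

Lemma predual_functional_le (phi : F) a : `|iota a phi| <= `|phi| * `|a|.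
Proof. by rewrite mulrC -iota_isometry ler_dual_norm. Qed.

Definition predual_functional (phi : F) : dual A :=
  dual_of (predual_functional_linear phi)
    (ex_intro _ _ (predual_functional_le phi)).

Lemma predual_restrict_linear (m : bidual A) :
  linear (fun phi => m (predual_functional phi)).
Proof.
move=> c phi psi; rewrite -linearP; congr (m _).
by apply: dual_ext => a /=; rewrite linearP.
Qed.

Lemma predual_restrict_le (m : bidual A) phi :
  `|m (predual_functional phi)| <= `|m| * `|phi|.
Proof.
rewrite (le_trans (ler_dual_norm _ _))// ler_wpM2l//.
by apply: dual_norm_le => // a; exact: predual_functional_le.
Qed.

(** The Banach space adjoint of the canonical map [predual_functional] from [F] to [A*]. *)
Definition predual_restrict (m : bidual A) : dual F :=
  dual_of (predual_restrict_linear m) (ex_intro _ _ (predual_restrict_le m)).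

Definition predual_proj (m : bidual A) : A := iota_inv (predual_restrict m).

(** Together with [predual_proj_unique], this characterises [predual_proj m], so identities about it
    need testing only on functionals from the predual. *)
Lemma predual_projE (m : bidual A) f : predual_image iota f -> m f = f (predual_proj m).
Proof.
case=> phi fE; rewrite fE /= iota_invK /=; congr (m _).
by apply: dual_ext => a; rewrite fE.
Qed.

Lemma predual_image_functional phi :
  predual_image iota (predual_functional phi).
Proof. by exists phi. Qed.

(* The image of the predual separates the points of [A]. *)
Lemma predual_proj_unique (m : bidual A) a :
  (forall f, predual_image iota f -> m f = f a) -> predual_proj m = a.
Proof.
move=> ma; rewrite -[RHS]iotaK; congr iota_inv; apply: dual_ext => phi /=.
exact/ma/predual_image_functional.
Qed.

Lemma linear_predual_proj : linear predual_proj.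
Proof.
move=> c m n; apply: predual_proj_unique => f fF.
by rewrite dualDE dualZE linearP (predual_projE m)// (predual_projE n).
Qed.

Lemma predual_proj_le m : `|predual_proj m| <= `|m|.
Proof.
rewrite -iota_isometry iota_invK.
by apply: dual_norm_le => // phi; exact: predual_restrict_le.
Qed.

Lemma bidual_embedK : cancel (@bidual_embed R A) predual_proj.
Proof. by move=> a; apply: predual_proj_unique. Qed.

Lemma predual_projM : {morph predual_proj : m n / m ** n}.
Proof.
move=> m n; apply: predual_proj_unique => f fF.
case: predual_submodule => _ _ _ lactF ractF.
(* Right stability keeps [f.a] in the image of the predual, where [n] acts as evaluation at
   [predual_proj n]. *)
have nf : bidual_act n f = dual_lact (predual_proj n) f.
  by apply: dual_ext => a /=; rewrite predual_projE//; exact: ractF.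
(* Left stability puts [n.f] back in that image, so [m] too becomes evaluation at its projection. *)
by rewrite arensE nf predual_projE//; exact: lactF.
Qed.

End PredualProjection.

Theorem theorem3p2 (R : realType) (k : nat) (A : banachAlgType R[i])
    (k_ge2 : (2 <= k)%N) (A_dual : dual_banach_algebra A)
    (bidual_OA : OA_property k (bidual A)) :
  OA_property k A.
Proof.
case: A_dual => F [iota [[iota_inv iotaK iota_invK] iota_isometry submod]].
pose proj := predual_proj iota_inv iota_isometry.
pose proj_lin := GRing.isLinear.Build _ _ _ _ proj
  (linear_predual_proj iotaK iota_invK iota_isometry).
pose p : {linear bidual A -> A} := HB.pack proj proj_lin.
pose emb_lin := GRing.isLinear.Build _ _ _ _ _ (@linear_bidual_embed R A).
pose e : {linear A -> bidual A} := HB.pack (@bidual_embed R A) emb_lin.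
apply: (@OA_property_retract R k A (bidual A) p e) bidual_OA.
- exact: (predual_projM iotaK iota_invK iota_isometry submod).
- exact: bidual_embedM.
- by exists 1 => m; rewrite mul1r; exact: predual_proj_le.
- by exists 1 => a; rewrite mul1r; exact: bidual_embed_le.
- exact: bidual_embedK.
Qed.
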